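(* Let $(X,\mathfrak{V})$ be an iterated function system, with $X$ a compact metric space with metric $d$. Then $$\mathrm{mdim}(X,\mathfrak{V}) \le \underline{\mathrm{mdim}}_M(X,\mathfrak{V}) \le \overline{\mathrm{mdim}}_M(X,\mathfrak{V}),$$ where $\mathrm{mdim}$ is the mean dimension and $\underline{\mathrm{mdim}}_M$, $\overline{\mathrm{mdim}}_M$ are the lower and upper metric mean dimensions (with respect to $d$).
   Context: Iterated function system: $X$ is a compact metric space with metric $d$, and $\mathfrak V$ is a (possibly infinite) family of homeomorphisms $v:D(v)\to v(D(v))\subset X$ with closed domain $D(v)\subset X$. The pair $(X,\mathfrak V)$ is an iterated function system (IFS) if there is a set $O\subset X$ with $\emptyset\neq\bigcup_{v\in\mathfrak V}v(D(v)\cap O)\subset\bigcup_{v\in\mathfrak V}(D(v)\cap O)$. Orbits: $\mathbb N=\{1,2,\dots\}$, $\Sigma=\mathfrak V^{\mathbb N}$ is the set of sequences $\sigma=(v_1,v_2,\dots)$ with $v_i\in\mathfrak V$. For $\sigma\in\Sigma$ and $x\in X$, $v^{\sigma(n)}(x)=v_n\circ\cdots\circ v_1(x)$ whenever well defined, $v^{\sigma(0)}(x)=x$. $\Sigma_x=\{\sigma\in\Sigma: v^{\sigma(n)}(x)\text{ is well defined for all }n\in\mathbb N\}$, $\Sigma_\sigma=\{x\in X: v^{\sigma(n)}(x)\text{ is well defined for all }n\in\mathbb N\}$ (a closed subset of $X$, possibly empty), and $\Psi(X)=\{(x,\sigma):x\in X,\sigma\in\Sigma_x\}$. Metric mean dimension: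 a set $R\subset\Psi(X)$ is $(n,\epsilon)$-spanning if for every $(x,\sigma)\in\Psi(X)$ there is $(y,\varphi)\in R$ with $d(v^{\sigma(i)}(x),v^{\varphi(i)}(y))<\epsilon$ for all $0\le i\le n-1$; $r(n,\epsilon)$ is the minimum cardinality of an $(n,\epsilon)$-spanning set. Then $$\overline{\mathrm{mdim}}_M(X,\mathfrak V)=\limsup_{\epsilon\to0}\frac1{|\log\epsilon|}\limsup_{n\to\infty}\frac1n\log r(n,\epsilon),\qquad \underline{\mathrm{mdim}}_M(X,\mathfrak V)=\liminf_{\epsilon\to0}\frac1{|\log\epsilon|}\limsup_{n\to\infty}\frac1n\log r(n,\epsilon).$$ Mean dimension: for covers $\alpha,\beta$ of a set, $\beta\succ\alpha$ ($\beta$ refines $\alpha$) means every $U\in\beta$ is contained in some $V\in\alpha$. For a nonempty closed $A\subset X$ and an open cover $\alpha$ of $A$, $\mathrm{ord}(\alpha,A)=\max_{x\in A}\sum_{U\in\alpha}1_U(x)-1$ and $\mathcal D(\alpha)=\min_{\beta\succ\alpha}\mathrm{ord}(\beta,A)$, with $\beta$ ranging over finite open covers of $A$ refining $\alpha$. For an open cover $\alpha$ of $X$ and $\sigma\in\Sigma$, $\alpha_0^{n-1}(\sigma)$ is the open cover of $\Sigma_\sigma$ (as a space with the relative topology) consisting of all sets $\bigcap_{i=0}^{n-1}\{x\in\Sigma_\sigma: v^{\sigma(i)}(x)\in U_i\}$ with $U_0,\dots,U_{n-1}\in\alpha$. With $\mathcal U_X$ the set of finite open covers of $X$, $$\mathrm{mdim}(X,\mathfrak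 V,\sigma)=\sup_{\alpha\in\mathcal U_X}\limsup_{n\to\infty}\frac{\mathcal D(\alpha_0^{n-1}(\sigma))}{n},\qquad \mathrm{mdim}(X,\mathfrak V)=\sup_{\sigma\in\Sigma}\mathrm{mdim}(X,\mathfrak V,\sigma),$$ with the convention $\mathrm{mdim}(X,\mathfrak V,\sigma)=0$ if $\Sigma_\sigma=\emptyset$. *)

(* Defs.v *)
From mathcomp Require Import all_boot all_order all_algebra.
From mathcomp Require Import all_classical all_reals all_analysis.

Set Implicit Arguments.
Unset Strict Implicit.
Unset Printing Implicit Defensive.

Import Order.TTheory GRing.Theory Num.Theory.
Import numFieldNormedType.Exports.

Local Open Scope classical_set_scope.
Local Open Scope ring_scope.

(* The family of partial maps is indexed by a type I: the i-th map has domain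
   D i, and the values of v i outside D i are irrelevant. Sequences of maps are
   indexed from 0, so that the map applied first is v (s 0). *)

Definition homeo_on (X : topologicalType) (A : set X) (f : X -> X) : Prop :=
  {within A, continuous f} /\
  exists2 g : X -> X, {within f @` A, continuous g} & {in A, cancel f g}.

Definition is_ifs (X : topologicalType) (I : Type) (D : I -> set X)
    (v : I -> X -> X) : Prop :=
  [/\ forall i, closed (D i),
      forall i, homeo_on (D i) (v i) &
      exists O : set X,
        \bigcup_i (v i @` (D i `&` O)) !=set0 /\
        \bigcup_i (v i @` (D i `&` O)) `<=` \bigcup_i (D i `&` O)].

Section Orbits.
Context {X I : Type} (D : I -> set X) (v : I -> X -> X).

Fixpoint orb (s : nat -> I) (n : nat) (x : X) : X :=
  if n is m.+1 then v (s m) (orb s m x) else x.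

Definition seq_dom (s : nat -> I) : set X :=
  [set x | forall n, D (s n) (orb s n x)].

Definition Psi : set (X * (nat -> I)) := [set p | seq_dom p.2 p.1].

End Orbits.

Section MetricMeanDimension.
Context {R : realType} {X : metricType R} {I : Type}.
Variables (D : I -> set X) (v : I -> X -> X).

Definition spanning (n : nat) (e : R) (S : set (X * (nat -> I))) : Prop :=
  S `<=` Psi D v /\
  forall p, Psi D v p -> exists2 q, S q &
    forall i, (i < n)%N -> mdist (orb v p.2 i p.1) (orb v q.2 i q.1) < e.

(* Equal to +oo if there were no finite spanning set, which cannot happen when
   X is compact and 0 < e. *)
Definition span_number (n : nat) (e : R) : \bar R :=
  ereal_inf [set (k%:R)%:E | k in
    [set k : nat | exists2 S, spanning n e S & (S #= `I_k)%card]].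

Definition span_growth (e : R) : \bar R :=
  limn_esup (fun n : nat => ((n%:R)^-1)%:E * lne (span_number n e))%E.

Definition upper_mmdim : \bar R :=
  limf_esup (fun e : R => (`|ln e|^-1)%:E * span_growth e)%E (0^'+).

Definition lower_mmdim : \bar R :=
  limf_einf (fun e : R => (`|ln e|^-1)%:E * span_growth e)%E (0^'+).

End MetricMeanDimension.

Section MeanDimension.
Context (R : realType) {X : topologicalType}.

Definition finite_open_cover (A : set X) (b : set (set X)) : Prop :=
  [/\ finite_set b, b `<=` [set A `&` W | W in open] &
      \bigcup_(U in b) U = A].

Definition refines (b a : set (set X)) : Prop :=
  forall U, b U -> exists2 V, a V & U `<=` V.

(* The sum ranges over a finite support: meaningful for finite covers only. *)
Definition cover_ord (b : set (set X)) (A : set X) : \bar R :=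
  ereal_sup [set ((\sum_(U \in b) (\1_U x : R)) - 1)%:E | x in A].

Definition cover_dim (A : set X) (a : set (set X)) : \bar R :=
  ereal_inf [set cover_ord b A | b in
    [set b | finite_open_cover A b /\ refines b a]].

Context {I : Type}.
Variables (D : I -> set X) (v : I -> X -> X).

Definition join_cover (a : set (set X)) (s : nat -> I) (n : nat) :
    set (set X) :=
  [set [set x | seq_dom D v s x /\ forall i, (i < n)%N -> U i (orb v s i x)]
    | U in [set U : nat -> set X | forall i, (i < n)%N -> a (U i)]].

Definition seq_mdim (s : nat -> I) : \bar R :=
  if `[< seq_dom D v s = set0 >] then 0%E else
  ereal_sup [set limn_esup (fun n : nat =>
      cover_dim (seq_dom D v s) (join_cover a s n) * ((n%:R)^-1)%:E)%E
    | a in finite_open_cover [set: X]].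

Definition mdim : \bar R := ereal_sup (range seq_mdim).

End MeanDimension.

(* Main.v *)
(* Cover X by finitely many sets of the form w_i < - rho, with w_i nonexpansive
   and {w_i < rho} inside a member of the cover, and for a sequence s consider
   the functions w_i (orb s t x), t < n. Choose for each of them a threshold in
   a grid of Q ~ rho / (2 e) points of mesh 2 e. Since an orbit is e-shadowed by
   one of the r(n, e) orbits of a spanning set, counting grid points shows that
   for a suitable choice no point of the domain of s attains more than m
   thresholds at once, where Q ^ m <= r(n, e) * 2 ^ (n l), l being the number
   of w_i. Sorting points by which functions are closest to their thresholds and
   by the sides of the other ones then gives an open cover of order at most m
   which refines the n-th join. So m / n * ln Q <= ln (r(n, e)) / n + l * ln 2,
   and ln Q ~ |ln e| as e tends to 0. *)

From HB Require Import structures.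
Require Import Defs.
From mathcomp Require Import all_boot all_order all_algebra.
From mathcomp Require Import all_classical all_reals all_analysis.
From mathcomp Require Import lra.

Set Implicit Arguments.
Unset Strict Implicit.
Unset Printing Implicit Defensive.

Import Order.TTheory GRing.Theory Num.Theory.
Import numFieldNormedType.Exports.

Local Open Scope classical_set_scope.
Local Open Scope ring_scope.

(** * Averaging over the choice of thresholds *)

(* Average over xi of the sum over q of Q ^ #hits: for each q it factors over K
   into sums of at most Q - 1 ones and one Q. *)
Lemma few_hits (K : finType) (Q r : nat) (h : 'I_r -> K -> 'I_Q -> bool) :
  (0 < Q)%N -> (forall q k i j, h q k i -> h q k j -> i = j) ->
  exists xi : {ffun K -> 'I_Q}, forall q,
    (Q ^ #|[set k | h q k (xi k)]%SET| <= r * 2 ^ #|K|)%N.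
Proof.
move=> Q0 h1.
pose wt (xi : {ffun K -> 'I_Q}) q := (\prod_(k : K) Q ^ h q k (xi k))%N.
have wtE xi q : wt xi q = (Q ^ #|[set k | h q k (xi k)]%SET|)%N.
  rewrite -sum1_card expn_sum big_mkcond /=; apply: eq_bigr => k _.
  by rewrite inE; case: (h q k _).
have row q k : (\sum_(j < Q) Q ^ h q k j <= 2 * Q)%N.
  have [[j hj]|nh] := pselect (exists j, h q k j); last first.
    rewrite (eq_bigr (fun=> 1%N)) => [|j _].
      by rewrite sum1_card card_ord leq_pmull.
    by case E: (h q k j) => //; case: nh; exists j.
  rewrite (bigD1 j) //= hj expn1 mul2n -addnn leq_add2l.
  rewrite (eq_bigr (fun=> 1%N)) => [|i ij].
    by rewrite sum1_card (leq_trans (max_card _)) ?card_ord.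
  by case E: (h q k i) => //; rewrite (h1 _ _ _ _ E hj) eqxx in ij.
have tot : (\sum_xi \sum_q wt xi q <=
    \sum_(xi : {ffun K -> 'I_Q}) r * 2 ^ #|K|)%N.
  rewrite exchange_big /= sum_nat_const card_ffun card_ord mulnCA -expnMn.
  rewrite [(Q * 2)%N]mulnC.
  rewrite -[X in (_ <= X * _)%N](card_ord r) -sum_nat_const.
  apply: leq_sum => q _; rewrite /wt.
  rewrite -(bigA_distr_bigA (fun k j => Q ^ h q k j)%N).
  by rewrite -prod_nat_const; apply: leq_prod => k _; exact: row.
have [xi Hxi] : exists xi, (\sum_q wt xi q <= r * 2 ^ #|K|)%N.
  apply/not_existsP => no; move: tot; apply/negP; rewrite -ltnNge.
  apply: (@leq_trans (\sum_(xi : {ffun K -> 'I_Q}) (r * 2 ^ #|K|).+1)).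
    by rewrite !sum_nat_const ltn_pmul2l // card_ffun card_ord expn_gt0 Q0.
  by apply: leq_sum => xi _; rewrite ltnNge; apply/negP/no.
exists xi => q; rewrite -wtE (leq_trans _ Hxi) //.
by rewrite (bigD1 q) //= leq_addr.
Qed.

(** * Open covers of low order from finitely many functions *)

Section LowOrderCover.
Context {R : realType} {X : topologicalType} {K : finType}.
Variables (Y : set X) (g : K -> X -> R) (rho : R).
Hypotheses (rho_gt0 : 0 < rho) (g_cont : forall k, {within Y, continuous g k}).

(* Points at which the functions of smallest absolute value are those indexed
   by S, and the other ones have the sign prescribed by T. Two such cells with
   the same #|S| are disjoint or equal. *)
Let cell (S T : {set K}) : set X := [set x | [/\ Y x,
  forall k, k \in S -> `|g k x| < rho,
  forall k k', k \in S -> k' \notin S -> `|g k x| < `|g k' x| &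
  forall k, k \notin S -> 0 < (if k \in T then - g k x else g k x)]].

Let open_cell S T : exists2 O, open O & Y `&` O = cell S T.
Proof.
(* This [O] turns openness relative to [Y] into a statement about the filter [within Y (nbhs x)] at
   each point of the cell. *)
pose O := ([set x | Y x -> cell S T x])°.
exists O; first exact: open_interior.
apply/seteqP; split => [x [Yx Ox]|x cx]; first exact: (nbhs_singleton Ox).
have [Yx cS cST cT] := cx; split => //.
have gx k : g k y @[y --> within Y (nbhs x)] --> g k x.
  exact: (iffLR (subspace_continuousP Y (g k)) (@g_cont k)).
have nS : \forall y \near within Y (nbhs x),
    forall k, (k \in S) ==> (`|g k y| < rho).
  apply: filter_forall => k; case: (boolP (k \in S)) => kS /=;
    last exact: nearW.
  exact: (cvgr_lt _ (cvg_norm (gx k)) _ (cS _ kS)).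
have nST : \forall y \near within Y (nbhs x),
    forall p : K * K,
      (p.1 \in S) && (p.2 \notin S) ==> (`|g p.1 y| < `|g p.2 y|).
  apply: filter_forall => -[k k'] /=.
  case: (boolP (_ && _)) => [/andP[kS k'S]|_] /=; last exact: nearW.
  near=> y; rewrite -subr_gt0; near: y.
  apply: (cvgr_gt _ (cvgB (cvg_norm (gx k')) (cvg_norm (gx k)))).
  by rewrite subr_gt0 cST.
have nT : \forall y \near within Y (nbhs x),
    forall k, (k \notin S) ==> (0 < (if k \in T then - g k y else g k y)).
  apply: filter_forall => k; case: (boolP (k \in S)) => kS /=;
    first exact: nearW.
  move: (cT _ kS); case: ifP => _ gk.
    exact: (cvgr_gt _ (cvgN (gx k)) _ gk).
  exact: (cvgr_gt _ (gx k) _ gk).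
have nY : \forall y \near within Y (nbhs x), Y y by exact: withinT.
suff : \forall y \near within Y (nbhs x), cell S T y by [].
apply: filterS3 nY (filterI nS nST) nT => y Yy [{}nS {}nST] {}nT; split => //.
- by move=> k; apply/implyP/nS.
- by move=> k k' kS k'S; have /= := nST (k, k'); rewrite kS k'S; apply.
- by move=> k; apply/implyP/nT.
Unshelve. all: by end_near.
Qed.

Let cell_level S S' T T' x : cell S T x -> cell S' T' x -> #|S| = #|S'| ->
  cell S T = cell S' T'.
Proof.
move=> [Yx cS cST cT] [_ cS' cST' cT'] eqSS'.
(* Different sets of equal size would each contain an index missing from the other, and the two
   cells would order the corresponding absolute values at [x] in opposite ways. *)
have SS' : S = S'.
  apply/eqP; rewrite eqEcard eqSS' leqnn andbT; apply/fintype.subsetP => k kS.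
  apply/negPn/negP => kS'.
  have /fintype.subsetPn[k' k'S' k'S] : ~~ (S' \subset S).
    apply/negP => S'S; have /eqP eS : S' == S.
      by rewrite eqEcard S'S eqSS' leqnn.
    by rewrite eS kS in kS'.
  by have := lt_trans (cST _ _ kS k'S) (cST' _ _ k'S' kS'); rewrite ltxx.
subst S'.
have TT' k : k \notin S -> (k \in T) = (k \in T').
  move=> kS; move: (cT _ kS) (cT' _ kS).
  by case: ifP; case: ifP => // _ _; rewrite oppr_gt0 => /lt_trans/[apply];
    rewrite ltxx.
by apply/seteqP; split => y [Yy yS yST yT]; split => // k kS;
  have := yT _ kS; rewrite TT'.
Qed.

(** The cells with [#|S| <= m] cover [Y], and a point lies in at most one of them for each of the m
    + 1 possible sizes of [S]. *)
Lemma low_order_cover (m : nat) (a : set (set X)) : Y !=set0 ->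
  (forall x, Y x -> #|[set k | g k x == 0%R]%SET| <= m)%N ->
  (forall x, Y x -> exists2 V, a V &
     forall y, Y y -> (forall k, g k x <= - rho -> g k y < 0) -> V y) ->
  (cover_dim R Y a <= (m%:R)%:E)%E.
Proof.
move=> [x0 Yx0] zeros aY.
pose idx := [set p : {set K} * {set K} | (#|p.1| <= m)%N].
pose b := [set cell p.1 p.2 | p in idx].
have fb : finite_set b by apply: finite_image; exact: finite_finset.
apply: (@le_trans _ _ (cover_ord R b Y)).
  apply: ereal_inf_lbound; exists b => //; split.
    split => //.
      move=> _ [[S T] _ <-] /=; have [W oW <-] := open_cell S T.
      by exists W.
    apply/seteqP; split => [x [_ [p _ <-]] []//|x Yx].
    pose S := [set k | g k x == 0%R]%SET; pose T := [set k | g k x < 0]%SET.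
    exists (cell S T); first by exists (S, T) => //; exact: zeros.
    split => //.
    - by move=> k; rewrite inE => /eqP ->; rewrite normr0.
    - by move=> k k'; rewrite !inE => /eqP -> k'0; rewrite normr0 normr_gt0.
    - move=> k; rewrite !inE => k0; have [gk|gk] := ltP (g k x) 0.
        by rewrite oppr_gt0.
      by rewrite lt_neqAle eq_sym k0.
  (* An index with [g k x <= - rho] lies outside [S], so [g k] stays negative on the whole cell. An
     empty cell fits in any member of [a], and [x0] supplies one. *)
  move=> _ [[S T] _ <-] /=; have [[x cx]|ce] := pselect (cell S T !=set0).
    have [Yx cS cST cT] := cx.
    have [V aV HV] := aY _ Yx; exists V => // y [Yy yS yST yT].
    apply: HV => // k gkx; have kS : k \notin S.
      apply/negP => /cS; apply/negP.
      by rewrite -leNgt -normrN (le_trans _ (ler_norm _)) // lerNr.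
    move: (cT _ kS) (yT _ kS); case: ifP => _; first by rewrite !oppr_gt0.
    by rewrite ltNge (le_trans gkx) // oppr_le0 ltW.
  have [V aV _] := aY _ Yx0; exists V => // y cy; case: ce; by exists y.
apply: ge_ereal_sup => _ [x Yx <-]; rewrite lee_fin lerBlDr natr1.
rewrite fsbig_finite //=.
have -> : \sum_(U <- finmap.enum_fset (fset_set b)) \1_U x =
    (size [seq U <- finmap.enum_fset (fset_set b) | `[< U x >]])%:R :> R.
  elim: (finmap.enum_fset _) => [|U s IHs]; first by rewrite big_nil.
  rewrite big_cons IHs /= indicE /=; case: asboolP => Ux.
    by rewrite mem_set //= -[in RHS]natr1 addrC.
  by rewrite memNset // add0r.
rewrite ler_nat; set s := [seq _ <- _ | _].
(* Sending a cell to the size of its [S] is injective on the cells through [x], with values in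
   0..m. *)
have level U : exists j, U \in s ->
    exists S T, [/\ U = cell S T, #|S| = j & (j <= m)%N].
  have [|] := boolP (U \in s); last by exists 0%N.
  rewrite mem_filter => /andP[_]; rewrite in_fset_set // => /set_mem
    [[S T] Sm <-].
  by exists #|S| => _; exists S, T.
have [lv lvP] := choice level.
have -> : m.+1 = size (iota 0 m.+1) by rewrite size_iota.
rewrite -(size_map lv); apply: uniq_leq_size.
  rewrite map_inj_in_uniq; first by rewrite filter_uniq // finmap.fset_uniq.
  move=> U U' Us U's; have [S [T [UE lS _]]] := lvP _ Us.
  have [S' [T' [U'E lS' _]]] := lvP _ U's.
  move=> ll; rewrite UE U'E; move: Us U's; rewrite !mem_filter UE U'E.
  move=> /andP[/asboolP cx _] /andP[/asboolP cx' _]; apply: (cell_level cx cx').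
  by rewrite lS lS'.
by move=> j /mapP[U /lvP[S [T [_ _ lm]]] ->]; rewrite mem_iota.
Qed.
End LowOrderCover.

(** * Nonexpansive functions along orbits and spanning sets *)

Lemma orb_continuous (X : topologicalType) (I : Type) (D : I -> set X)
    (v : I -> X -> X) (s : nat -> I) (n : nat) :
  (forall i, {within D i, continuous v i}) ->
  {within seq_dom D v s, continuous orb v s n}.
Proof.
move=> v_cont; elim: n => [|n IHn].
  by apply: continuous_subspaceT => x; exact: cvg_id.
apply/subspace_continuousP => x Yx A /=.
move/(iffLR (subspace_continuousP _ (v (s n))) (@v_cont (s n)) _ (Yx n)).
move/(iffLR (subspace_continuousP _ _) IHn _ Yx) => nA.
have {}nA : \forall y \near x, seq_dom D v s y ->
  D (s n) (orb v s n y) -> A (v (s n) (orb v s n y)) := nA.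
suff : \forall y \near x, seq_dom D v s y -> A (v (s n) (orb v s n y)) by [].
by apply: filterS nA => y vA Yy; exact: vA Yy (Yy n).
Qed.

Lemma nonexpansive_continuous (R : realType) (X : metricType R) (w : X -> R) :
  (forall x y, w x - w y <= mdist x y) -> continuous w.
Proof.
move=> w_lip x; apply/cvgrPdist_lt => e e0.
have nx : \forall y \near x, mdist x y < e.
  exact: (metricType_numDomainType.cvgr_dist_lt (@cvg_id _ (nbhs x))).
apply: filterS nx => y xy; rewrite (le_lt_trans _ xy) // ler_norml w_lip andbT.
by rewrite lerNl opprB metric_sym w_lip.
Qed.

(** Take a finite subcover by balls of radius r whose concentric balls of radius 3 r lie in members
    of [a]. Distance to the centre minus 2 r works, with [rho] below all these radii. *)
Lemma nonexpansive_cover (R : realType) (X : metricType R) (a : set (set X)) :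
  compact [set: X] -> finite_open_cover [set: X] a -> [set: X] !=set0 ->
  exists (K : finType) (w : K -> X -> R) (rho : R),
    [/\ 0 < rho, forall k x y, w k x - w k y <= mdist x y,
        forall x, exists k, w k x < - rho &
        forall k, exists2 V, a V & forall x, w k x < rho -> V x].
Proof.
move=> cX [_ a_open a_cover] [x0 _].
have /choice[r rP] (x : X) : exists r : R, 0 < r /\
    exists2 V, a V & forall y, mdist x y < 3 * r -> V y.
  have [V aV Vx] : (\bigcup_(U in a) U) x by rewrite a_cover.
  have [W oW WV] := a_open _ aV.
  have /nbhs_ballP[e /= e0 eV] : nbhs x V.
    rewrite -WV setTI; apply: open_nbhs_nbhs; split => //.
    by rewrite -WV in Vx; case: Vx.
  exists (e / 3); split; first by rewrite divr_gt0.
  exists V => // y xy; apply: eV; rewrite ballEmdist /=.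
  by rewrite mulrC divfK ?pnatr_eq0 in xy.
pose X' : ptopologicalType := HB.pack (X : Type) X (isPointed.Build X x0).
have : @cover_compact X' [set: X'] by rewrite -compact_cover.
move=> /(_ X setT (fun x => (ball x (r x))°)) [|x _|].
- by move=> x _; exact: open_interior.
- exists x => //; rewrite /interior; apply: nbhsx_ballx; exact: (rP x).1.
move=> F _ Fcover.
pose K : finType := seq_sub (finmap.enum_fset F).
exists K, (fun k x => mdist (\val k) x - 2 * r (\val k)).
have [rho [rho0 rhoP]] : exists rho : R, 0 < rho /\
    forall k : K, rho < r (\val k).
  near (0:R)^'+ => e; exists e; split; first by near: e; exact: nbhs_right_gt.
  near: e; apply: filter_forall => k; apply: nbhs_right_lt; exact: (rP _).1.
exists rho; split => //.
- by move=> k x y; have := metric_triangle (\val k) y x;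
    rewrite (metric_sym y x); lra.
- move=> x; have [y /= yF xy] := Fcover x I.
  exists (SeqSub yF); have := rhoP (SeqSub yF).
  by move/interior_subset: xy; rewrite ballEmdist /=; lra.
- move=> k; have [_ [V aV VP]] := rP (\val k); exists V => // x xr.
  by apply: VP; have := rhoP k; lra.
Unshelve. all: by end_near.
Qed.

Lemma cover_dim_spanning (R : realType) (X : metricType R) (I : Type)
    (D : I -> set X) (v : I -> X -> X) (a : set (set X)) (s : nat -> I)
    (K : finType) (w : K -> X -> R) (rho e : R) (n Q k : nat)
    (S : set (X * (nat -> I))) :
  (forall i, {within D i, continuous v i}) -> seq_dom D v s !=set0 ->
  (forall i x y, w i x - w i y <= mdist x y) ->
  (forall x, exists i, w i x < - rho) ->
  (forall i, exists2 V, a V & forall x, w i x < rho -> V x) ->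
  0 < e -> (0 < Q)%N -> 2 * e * Q%:R <= rho ->
  spanning D v n e S -> (S #= `I_k)%card ->
  exists m,
    (cover_dim R (seq_dom D v s) (join_cover D v a s n) <= (m%:R)%:E)%E /\
    (Q ^ m <= k * 2 ^ (n * #|K|))%N.
Proof.
move=> v_cont [x0 Yx0] w_lip /choice[idx idxP].
move=> w_in e0 Q0 Qrho [_ Sspan] /card_set_bijP[f [f_k f_inj _]].
have /choice[V VP] i : exists V, a V /\ forall x, w i x < rho -> V x.
  by have [V aV VP] := w_in i; exists V.
have [q qP] : exists q : 'I_k -> X * (nat -> I),
    forall p, S p -> exists i, q i = p.
  have /choice[q qP] (i : 'I_k) : exists p,
      forall p', S p' -> f p' = i -> p' = p.
    have [[p [Sp fp]]|no] := pselect (exists p, S p /\ f p = i); last first.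
      by exists (x0, s) => p Sp fp; case: no; exists p.
    by exists p => p' Sp' fp'; apply: f_inj; rewrite ?inE // fp.
  exists q => p Sp; exists (Ordinal (f_k p Sp)).
  exact/esym/qP.
(* The grid points 2 e j are 2 e apart, so a value is within e of at most one of them; this is the
   uniqueness required by [few_hits]. *)
pose h (i : 'I_k) (tj : 'I_n * K) (j : 'I_Q) :=
  `|w tj.2 (orb v (q i).2 tj.1 (q i).1) - 2 * e * j%:R| < e.
have [||xi xiP] := @few_hits _ Q k h.
- by [].
- move=> i tj j j'; rewrite /h !ltr_distlC => /andP[h1 h2] /andP[h3 h4].
  apply/val_inj; case: (ltngtP (val j) (val j')) => // jj; exfalso;
    move: jj; rewrite -(ler_nat R) -natr1 -(ler_pM2l (_ : 0 < 2 * e))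
      ?mulr_gt0 //=;
    lra.
pose g (tj : 'I_n * K) x := w tj.2 (orb v s tj.1 x) - 2 * e * (xi tj)%:R.
have [i0 _] : exists i0 : 'I_k, True.
  by have [p /qP[i _] _] := Sspan (x0, s) Yx0; exists i.
(* The order bound m is the largest number of thresholds approached within e by a single spanning
   orbit. *)
pose hits i := #|[set tj | h i tj (xi tj)]%SET|.
have k0 : (0 < #|'I_k|)%N by apply/card_gt0P; exists i0.
have [i1 i1P] := @bigop.eq_bigmax _ hits k0.
exists (hits i1); split; last first.
  by rewrite (leq_trans (xiP i1)) // card_prod card_ord.
apply: (@low_order_cover R X _ (seq_dom D v s) g rho).
- by rewrite (lt_le_trans _ Qrho) // !mulr_gt0 // ltr0n.
- move=> tj; apply: (@within_continuous_comp _ _ _ _ (orb v s tj.1)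
    (fun x => w tj.2 x - 2 * e * (xi tj)%:R)).
    move=> x _; apply: cvgB; last exact: cvg_cst.
    exact: nonexpansive_continuous.
  exact: orb_continuous.
- by exists x0.
(* A threshold attained along the orbit of [x] is approached within e by the shadowing orbit, as [w]
   is nonexpansive. *)
- move=> x Yx; rewrite -i1P.
  have [p Sp xp] := Sspan (x, s) Yx; have [i qi] := qP _ Sp.
  apply: (leq_trans _ (@bigop.leq_bigmax _ hits i)).
  apply/subset_leq_card/fintype.subsetP => tj.
  rewrite !inE /g /h subr_eq0 => /eqP <-.
  rewrite qi; have := xp _ (ltn_ord tj.1) => /=; apply: le_lt_trans.
  by rewrite ler_norml lerNl opprB w_lip metric_sym w_lip.
(* Thresholds lie between 0 and [rho]: hence w < - rho at time t for [x] gives g <= - rho there, and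
   g < 0 for [y] gives w < rho, which places [y] in the same member of [a]. *)
- move=> x Yx; pose U t := V (idx (orb v s t x)).
  exists [set y | seq_dom D v s y /\ forall t, (t < n)%N -> U t (orb v s t y)].
    by exists U => // t _; exact: (VP _).1.
  move=> y Yy gxy; split => // t tn.
  pose tj := (Ordinal tn, idx (orb v s t x)).
  have xi0 : 0 <= 2 * e * (xi tj)%:R by rewrite !mulr_ge0 // ltW.
  have xiQ : 2 * e * (xi tj)%:R <= rho.
    by rewrite (le_trans _ Qrho) // ler_pM2l ?mulr_gt0 // ler_nat ltnW.
  have := gxy tj; rewrite /g /=; have := idxP (orb v s t x).
  by move=> wx gtj; apply: (VP _).2; lra.
Qed.

(** * Upper and lower limits along a filter *)

Section UpperLowerLimits.
Context {R : realType} {T : choiceType} {X : filteredType T}.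
Variables (f : X -> \bar R) (F : set_system X).
Local Open Scope ereal_scope.

Lemma limf_esup_lt {FF : Filter F} c :
  limf_esup f F < c -> \forall x \near F, f x < c.
Proof.
rewrite limf_esupE => /ereal_inf_lt[_ [V FV <-] Vc].
apply: filterS FV => x Vx; apply: le_lt_trans Vc.
by apply: ereal_sup_ubound; exists x.
Qed.

Lemma limf_esup_le c : (\forall x \near F, f x <= c) -> limf_esup f F <= c.
Proof.
move=> fc; rewrite limf_esupE.
apply: (@le_trans _ _ (ereal_sup (f @` [set x | f x <= c]))).
  by apply: ereal_inf_lbound; exists [set x | f x <= c].
by apply: ge_ereal_sup => _ [x fx <-].
Qed.

Lemma limf_einf_lt c V : F V -> limf_einf f F < c -> exists2 x, V x & f x < c.
Proof.
move=> FV; rewrite limf_einfE => Fc.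
have : ereal_inf (f @` V) < c.
  by apply: le_lt_trans Fc; apply: ereal_sup_ubound; exists V.
by move=> /ereal_inf_lt[_ [x Vx <-] xc]; exists x.
Qed.

Lemma limf_einf_ge0 {FF : Filter F} :
  (forall x, 0 <= f x) -> 0 <= limf_einf f F.
Proof.
move=> f0; rewrite limf_einfE.
apply: (@le_trans _ _ (ereal_inf (f @` setT))).
  by apply: le_ereal_inf_tmp => _ [x _ <-].
by apply: ereal_sup_ubound; exists setT => //; exact: filterT.
Qed.

Lemma limf_einf_sup {FF : ProperFilter F} : limf_einf f F <= limf_esup f F.
Proof.
rewrite limf_einfE limf_esupE.
apply: ge_ereal_sup => _ [V FV <-]; apply: le_ereal_inf_tmp => _ [W FW <-].
have [x [Vx Wx]] := filter_ex (filterI FV FW).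
apply: (@le_trans _ _ (f x)).
  by apply: ereal_inf_lbound; exists x.
by apply: ereal_sup_ubound; exists x.
Qed.

End UpperLowerLimits.

(** * Spanning numbers and nonnegativity *)

(** The invariance condition supplies, at each image point, a next map defined there, so an infinite
    orbit can be built step by step. *)
Lemma Psi_nonempty (X : topologicalType) (I : Type) (D : I -> set X)
    (v : I -> X -> X) : is_ifs D v -> Psi D v !=set0.
Proof.
case=> _ _ [A [[_ [i0 _ [x0 [Dx0 Ax0] _]]] stable]].
pose P x := exists i, D i x /\ A x.
have /choice[c cP] x : exists i, P x -> D i x /\ A x.
  have [[i Pxi]|nPx] := pselect (P x); first by exists i.
  by exists i0.
pose y := fix y n := if n is m.+1 then v (c (y m)) (y m) else x0.
have Py n : P (y n).
  elim: n => [|n /cP Dn]; first by exists i0.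
  have [|i _ [Di Ai]] := stable (y n.+1); last by exists i.
  by exists (c (y n)) => //; exists (y n).
pose s n := c (y n).
have yE n : orb v s n x0 = y n by elim: n => //= n ->.
by exists (x0, s) => n /=; rewrite yE; case: (cP _ (Py n)).
Qed.

Section SpanNumber.
Context {R : realType} {X : metricType R} {I : Type}.
Variables (D : I -> set X) (v : I -> X -> X).
Local Open Scope ereal_scope.

Lemma span_number_attained (n : nat) (e : R) : span_number D v n e = +oo \/
  exists (k : nat) S, [/\ spanning D v n e S, (S #= `I_k)%card &
    span_number D v n e = (k%:R)%:E].
Proof.
rewrite /span_number; set A := [set k | _].
have [/asboolP exA|/asboolP noA] := boolP `[< exists k, A k >]; last first.
  left; rewrite (_ : A = set0) ?image_set0 ?ereal_inf0 //.
  by rewrite -subset0 => k Ak; apply: noA; exists k.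
right; have exA' : exists k, `[< A k >].
  by case: exA => k ?; exists k; apply/asboolP.
case: (ex_minnP exA') => k /asboolP Ak kmin.
have [S Sspan Sk] := Ak; exists k, S; split => //.
apply/eqP; rewrite eq_le; apply/andP; split.
  by apply: ereal_inf_lbound; exists k.
by apply: le_ereal_inf_tmp => _ [j /asboolP Aj <-];
  rewrite lee_fin ler_nat kmin.
Qed.

Hypothesis Psi0 : Psi D v !=set0.

Lemma span_number_ge1 (n : nat) (e : R) : 1 <= span_number D v n e.
Proof.
have [->|[k [S [[_ Sspan] Sk ->]]]] := span_number_attained n e.
  exact: leey.
rewrite lee_fin ler1n lt0n; apply/negP => /eqP k0.
have [p /Sspan[q Sq _]] := Psi0.
by move: Sk; rewrite k0 II0 card_eq0 => /eqP S0; rewrite S0 in Sq.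
Qed.

Lemma span_growth_ge0 (e : R) : 0 <= span_growth D v e.
Proof.
apply: limf_esup_ge0 => [|n]; first exact: filter_not_empty.
by rewrite mule_ge0 ?lee_fin ?invr_ge0 // lne_ge0 span_number_ge1.
Qed.

Lemma lower_mmdim_ge0 : 0 <= lower_mmdim D v.
Proof.
apply: limf_einf_ge0 => e.
by rewrite mule_ge0 ?lee_fin ?invr_ge0 // span_growth_ge0.
Qed.

End SpanNumber.

(** * Growth rates as e tends to 0 *)

(** Take logarithms in Q ^ m <= k * 2 ^ (n #|K|) and divide by n ln Q. The strict bound on
    [span_growth] makes the spanning numbers finite for large n. *)
Lemma mdim_growth_bound (R : realType) (X : metricType R) (I : Type)
    (D : I -> set X) (v : I -> X -> X) (a : set (set X)) (s : nat -> I)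
    (K : finType) (w : K -> X -> R) (rho e c : R) (Q : nat) :
  (forall i, {within D i, continuous v i}) -> seq_dom D v s !=set0 ->
  (forall i x y, w i x - w i y <= mdist x y) ->
  (forall x, exists i, w i x < - rho) ->
  (forall i, exists2 V, a V & forall x, w i x < rho -> V x) ->
  0 < e -> (1 < Q)%N -> 2 * e * Q%:R <= rho ->
  (span_growth D v e < c%:E)%E ->
  (limn_esup (fun n : nat =>
      cover_dim R (seq_dom D v s) (join_cover D v a s n) * ((n%:R)^-1)%:E)
    <= ((c + #|K|%:R * ln 2) / ln Q%:R)%:E)%E.
Proof.
move=> v_cont Y0 w_lip w_cover w_in e0 Q1 Qrho Gc.
have lnQ0 : 0 < ln (Q%:R : R) by rewrite ln_gt0 // ltr1n.
have Q0 : (0 < Q)%N by rewrite ltnW.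
apply: limf_esup_le.
apply: (@filterS2 _ \oo _ _ _ _ _ (limf_esup_lt Gc) (nbhs_infty_gt 0)).
move=> n Gn n0.
have n0R : 0 < n%:R :> R by rewrite ltr0n.
have [spanE|[k [S [Sspan Sk spanE]]]] := span_number_attained D v n e.
  by move: Gn; rewrite spanE /= gt0_muley ?lte_fin ?invr_gt0.
have [m [dim_m Qm]] := cover_dim_spanning v_cont Y0 w_lip w_cover w_in e0 Q0
  Qrho Sspan Sk.
have k0 : (0 < k)%N.
  by case: k Qm {Sk spanE} => // ; rewrite mul0n leqn0 expn_eq0 gtn_eqF.
move: Gn; rewrite spanE lne_EFin ?ltr0n // -EFinM lte_fin => Gn.
apply: (@le_trans _ _ ((m%:R)%:E * ((n%:R)^-1)%:E)%E).
  by apply: lee_wpmul2r => //; rewrite lee_fin invr_ge0 ltW.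
rewrite -EFinM lee_fin ler_pdivlMr // mulrAC ler_pdivrMr //.
have : m%:R * ln Q%:R <= ln k%:R + n%:R * #|K|%:R * ln 2 :> R.
  rewrite -natrM ![_%:R * ln _]mulr_natl -!lnXn ?ltr0n //.
  rewrite -lnM ?posrE ?ltr0n // -?natrX -?natrM ?ltr0n ?expn_gt0 //.
  by rewrite ler_ln ?posrE ?ltr0n ?muln_gt0 ?expn_gt0 ?k0 ?Q0 // ler_nat.
move: Gn; rewrite mulrC ltr_pdivrMr // => Gn mQ.
by rewrite (le_trans mQ) // mulrDl mulrC; lra.
Qed.

Lemma seq_mdim_le_lower (R : realType) (X : metricType R) (I : Type)
    (D : I -> set X) (v : I -> X -> X) (s : nat -> I) :
  compact [set: X] -> is_ifs D v -> (seq_mdim R D v s <= lower_mmdim D v)%E.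
Proof.
(* Nonnegativity settles the case of an empty domain and excludes the value -oo below. *)
move=> cX ifs; have low0 := lower_mmdim_ge0 (Psi_nonempty ifs).
rewrite /seq_mdim; case: asboolP => // /eqP/set0P Y0.
apply: ge_ereal_sup => _ [a a_cover <-].
have v_cont i : {within D i, continuous v i} by case: ifs => _ /(_ i)[].
have X0 : [set: X] !=set0 by case: Y0 => x _; exists x.
have [K [w [rho [rho0 w_lip w_cover w_in]]]] :=
  nonexpansive_cover cX a_cover X0.
set L := limn_esup _.
case low: (lower_mmdim D v) low0 => [r| |] // r0; last exact: leey.
(* Half of the slack makes the lower limit smaller than c; the other half absorbs the constants b
   and B. *)
apply/lee_addgt0Pr => eta' eta'0; pose eta := eta' / 2.
have eta0 : 0 < eta by rewrite divr_gt0.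
pose b := #|K|%:R * ln 2 : R; pose B := `|ln (rho / 4)| : R; pose c := r + eta.
(* With x = |ln e|, the condition x >= x0 is equivalent to c x + b <= (c + eta) (x - B), where x - B
   bounds ln Q from below. *)
pose x0 := (b + (c + eta) * B) / eta.
(* The three bounds on e give |ln e| = - ln e, Q >= 2 and |ln e| > x0 respectively. *)
pose e1 := Num.min (Num.min 1 (rho / 8)) (expR (- x0)).
have e1_gt0 : 0 < e1 by rewrite !lt_min ltr01 divr_gt0 // expR_gt0.
have near_e : (0^'+)%classic [set e : R | 0 < e < e1].
  near=> e; apply/andP; split; near: e.
    exact: nbhs_right_gt.
  exact: nbhs_right_lt.
have [e /= /andP[e0 ee1] Ge] : exists2 e : R, [set e : R | 0 < e < e1] e &
    ((`|ln e|^-1)%:E * span_growth D v e < c%:E)%E.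
  apply: (limf_einf_lt near_e); rewrite -/(lower_mmdim D v) low lte_fin.
  by rewrite ltrDl.
move: ee1; rewrite !lt_min => /andP[/andP[e_lt1 e_rho] e_exp].
pose x := - ln e.
have x_x0 : x0 < x by rewrite ltrNr -[ltRHS]expRK ltr_ln ?posrE ?expR_gt0.
have xE : `|ln e| = x by rewrite ltr0_norm // ln_lt0 // e0 e_lt1.
have x_gt0 : 0 < x by rewrite oppr_gt0 ln_lt0 // e0 e_lt1.
have {}Ge : (span_growth D v e < (c * x)%:E)%E.
  by move: Ge; rewrite xE lte_pdivrMl // muleC.
pose Q := Num.truncn (rho / (2 * e)).
have e20 : 0 < 2 * e by rewrite mulr_gt0.
have /andP[Q_le Q_gt] := truncn_itv (ltW (divr_gt0 rho0 e20)).
have Qrho : 2 * e * Q%:R <= rho.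
  by move: Q_le; rewrite ler_pdivlMr // mulrC.
(* Since rho / (2 e) > 4, rounding down loses less than half of it. *)
have Q_ge : rho / 4 / e <= Q%:R.
  move: Q_gt; rewrite -/Q -natr1 ltr_pdivrMr // ler_pdivrMr //; nra.
have Q1 : (1 < Q)%N.
  rewrite -(ler_nat R) (le_trans _ Q_ge) // ler_pdivlMr //; lra.
have lnQ0 : 0 < ln (Q%:R : R) by rewrite ln_gt0 // ltr1n.
have lnQ : x - B <= ln Q%:R.
  apply: (@le_trans _ _ (ln (rho / 4 / e))); last first.
    by rewrite ler_ln ?posrE ?divr_gt0 // ltr0n ltnW.
  rewrite ln_div ?posrE ?divr_gt0 // addrC lerD2r.
  by rewrite lerNl /B -normrN ler_norm.
have := mdim_growth_bound v_cont Y0 w_lip w_cover w_in e0 Q1 Qrho Ge.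
move=> /le_trans; apply; rewrite lee_fin ler_pdivrMr //.
have -> : r + eta' = c + eta by rewrite /c /eta; lra.
have c0 : 0 < c by rewrite ltr_wpDl // -lee_fin.
have : x0 * eta = b + (c + eta) * B by rewrite divfK ?gt_eqF.
rewrite -/b => x0E; nra.
Unshelve. all: by end_near.
Qed.

Theorem theorem1 (R : realType) (X : metricType R) (I : Type)
    (D : I -> set X) (v : I -> X -> X)
    (compactX : compact [set: X]) (ifs : is_ifs D v) :
  (mdim R D v <= lower_mmdim D v)%E /\
  (lower_mmdim D v <= upper_mmdim D v)%E.
Proof.
split; last exact: limf_einf_sup.
by apply: ge_ereal_sup => _ [s _ <-]; exact: seq_mdim_le_lower.
Qed.
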